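(* Let $F$ be a nonarchimedean local field containing $2n$ distinct $2n$-th roots of unity, let $r,n\ge 1$ be integers and $c,d\in\mathbb{Z}$. Let $\widetilde{G}$ be the (essentially) $n$-fold metaplectic cover of $G=GL_r(F)$ corresponding to the bilinear form $B_{c,d}$, let $\widetilde{T}$ be the preimage in $\widetilde{G}$ of the diagonal torus $T(F)$, and let $H$ be the maximal abelian subgroup of $\widetilde{T}$. Then \[\left|\widetilde{T}/H\right| = \frac{n^r}{\left|\left\{\boldsymbol{x}\in (\mathbb{Z}/n\mathbb{Z})^r: B_{c,d}(\boldsymbol{x}, \boldsymbol{y}) \equiv 0 \pmod{n} \text{ for all } \boldsymbol{y}\in(\mathbb{Z}/n\mathbb{Z})^r\right\}\right|}.\]
   Context: $B_{c,d}$ is the symmetric bilinear form on $\mathbb{Z}^r$ (identified with the cocharacter lattice $Y$ of $GL_r$ via the basis $\varepsilon_i^\vee(a)=\mathrm{diag}(1,\dots,a,\dots,1)$, $a$ in the $i$-th entry) given by $B_{c,d}(\boldsymbol{x},\boldsymbol{y})=\boldsymbol{x}^T A\boldsymbol{y}$, where $A$ is the $r\times r$ matrix with every diagonal entry equal to $c$ and every off-diagonal entry equal to $d$. The metaplectic cover is a central extension $1\to\mu_m\to\widetilde{G}\xrightarrow{p}G\to 1$ (with $n\mid m$, essentially of degree $n$) corresponding to $B_{c,d}$ under the Brylinski–Deligne correspondence; in particular, for $\boldsymbol{x},\boldsymbol{y}\in\widetilde{T}$ with $p(\boldsymbol{x})=\lambda(x)$, $p(\boldsymbol{y})=\mu(y)$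 ($\lambda,\mu\in Y$, $x,y\in F^\times$), the commutator is $[\boldsymbol{x},\boldsymbol{y}]=(x,y)_n^{B_{c,d}(\lambda,\mu)}$, where $(\cdot,\cdot)_n$ is the $n$-th Hilbert symbol. $H$ is the maximal abelian subgroup of $\widetilde{T}$ used by McNamara (the one containing the preimage of $T(\mathfrak{o})$, $\mathfrak{o}$ the ring of integers of $F$); by McNamara, $|\widetilde{T}/H|$ is the dimension of the space of Whittaker functions on a principal series representation of $\widetilde{G}$. *)

(* Defs.v *)
From HB Require Import structures.
From mathcomp Require Import all_boot all_order all_algebra all_fingroup.
From mathcomp Require Import all_solvable all_field.
From mathcomp Require Import boolp classical_sets functions cardinality.

Set Implicit Arguments.
Unset Strict Implicit.
Unset Printing Implicit Defensive.

Import Order.TTheory GRing.Theory Num.Theory.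

Local Open Scope ring_scope.
Local Open Scope classical_set_scope.

Definition has_unity_roots (F : fieldType) (k : nat) : Prop :=
  exists s : seq F, [/\ uniq s, size s = k & all (k.-unity_root) s].

(** * Nonarchimedean local fields

    A valuation is a function [v : F -> int] whose value at [0] is ignored;
    [vge v k x] stands for "v(x) >= k" with the convention v(0) = +oo. *)

Definition vge (F : fieldType) (v : F -> int) (k : int) (x : F) : bool :=
  (x == 0) || (k <= v x).

Definition is_discrete_valuation (F : fieldType) (v : F -> int) : Prop :=
  [/\ forall x y, x != 0 -> y != 0 -> v (x * y) = v x + v y,
      forall k x y, vge v k x -> vge v k y -> vge v k (x + y)
    & exists2 x, x != 0 & v x = 1].

Definition is_complete (F : fieldType) (v : F -> int) : Prop :=
  forall u : nat -> F,
    (forall k : int, exists N : nat,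
       forall i j, (N <= i)%N -> (N <= j)%N -> vge v k (u i - u j)) ->
    exists l : F, forall k : int, exists N : nat,
       forall i, (N <= i)%N -> vge v k (u i - l).

(** [s] is a system of representatives of the residue field. *)
Definition residue_card (F : fieldType) (v : F -> int) (q : nat) : Prop :=
  exists s : seq F,
    [/\ uniq s /\ size s = q,
        {in s, forall a, vge v 0 a},
        {in s &, forall a b, vge v 1 (a - b) -> a = b}
      & forall x, vge v 0 x -> exists2 a, a \in s & vge v 1 (x - a)].

Definition is_local_field (F : fieldType) (v : F -> int) : Prop :=
  [/\ is_discrete_valuation v, is_complete v & exists q, residue_card v q].

Definition unit_int (F : fieldType) (v : F -> int) (x : F) : Prop :=
  x != 0 /\ v x = 0.

(** * The local Artin map and the Hilbert symbol *)

Section Extension.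
Variables (F : fieldType) (v : F -> int) (L : fieldExtType F).

(** The ring of integers of [L]: the integral closure of that of [F]. *)
Definition ext_int (x : L) : Prop :=
  exists p : {poly F}, [/\ p \is monic, forall i, vge v 0 p`_i
    & root (map_poly (in_alg L) p) x].

(** Its maximal ideal: zero and the non-units. *)
Definition ext_max (x : L) : Prop := ext_int x /\ (x = 0 \/ ~ ext_int x^-1).

(** Uniformizers of [F] generate the maximal ideal.  Residue fields of local
    fields being perfect, there is no separability condition to add. *)
Definition unramified : Prop :=
  forall (pi : F) (x : L), pi != 0 -> v pi = 1 ->
    ext_max x -> ext_int (x / pi%:A).

End Extension.

Definition abelian_ext (F : fieldType) (L : splittingFieldType F) : Prop :=
  galois 1 {:L} /\ abelian 'Gal({:L} / 1).

(** The defining properties of the local Artin map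
    F^* -> Gal(F^ab / F), given by its components at the finite abelian
    extensions of [F]; local class field theory says that there is exactly one
    such family (on nonzero elements and abelian extensions).
    The normalization is the arithmetic one. *)
Record is_artin_map (F : fieldType) (v : F -> int)
    (artin : forall L : splittingFieldType F, F -> gal_of {:L}) : Prop :=
  IsArtinMap {
    artinM : forall L, abelian_ext L -> forall a b, a != 0 -> b != 0 ->
      artin L (a * b) = (artin L a * artin L b)%g;
    artin_compat : forall (L M : splittingFieldType F) (f : 'AHom(M, L)),
      abelian_ext L -> abelian_ext M -> forall a, a != 0 ->
      forall x, artin L a (f x) = f (artin M a x);
    artin_ker : forall L, abelian_ext L -> forall a, a != 0 ->
      artin L a = 1%g <-> exists x : L, galNorm 1 {:L} x = a%:A;
    artin_surj : forall L, abelian_ext L -> forall s : gal_of {:L},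
      exists2 a, a != 0 & artin L a = s;
    artin_frob : forall L, abelian_ext L -> unramified v L ->
      forall q, residue_card v q -> forall pi, pi != 0 -> v pi = 1 ->
      forall x : L, ext_int v x -> ext_max v (artin L pi x - x ^+ q) }.

(** (a, b)_n = Art(a)(b^(1/n)) / b^(1/n), a root of unity in [F]. *)
Definition is_hilbert_symbol (F : fieldType) (v : F -> int) (n : nat)
    (hilb : F -> F -> F) : Prop :=
  exists2 artin : forall L : splittingFieldType F, F -> gal_of {:L},
    is_artin_map v artin
  & forall a b, a != 0 -> b != 0 ->
    forall (L : splittingFieldType F) (beta : L), abelian_ext L ->
      beta ^+ n = b%:A -> artin L a beta = (hilb a b)%:A * beta.

(** * The form B_{c,d} and the torus of GL_r *)

Definition Bmx (r : nat) (c d : int) : 'M[int]_r :=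
  \matrix_(i, j) if i == j then c else d.

Definition Bform (r : nat) (c d : int) (x y : 'cV[int]_r) : int :=
  (x^T *m Bmx r c d *m y) 0 0.

Definition lift_Zn (r n : nat) (x : {ffun 'I_r -> 'I_n}) : 'cV[int]_r :=
  \col_i (x i : nat)%:Z.

(** (Z/n)^r is represented by vectors of residues in {0, ..., n-1}. *)
Definition Bradical (r n : nat) (c d : int) : {set {ffun 'I_r -> 'I_n}} :=
  [set x | [forall y : {ffun 'I_r -> 'I_n},
    (n%:Z %| Bform c d (lift_Zn x) (lift_Zn y))%Z]]%SET.

(** The element lambda(x) of the torus, for a cocharacter lambda in Y = Z^r. *)
Definition cochar (F : fieldType) (r : nat) (lambda : 'cV[int]_r) (x : F) :
    'M[F]_r :=
  diag_mx (\row_i (x ^ lambda i 0)).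

(** * Metaplectic covers of GL_r(F)

    [iota] is only meaningful on the group of m-th roots of unity. *)

Record is_central_extension (F : fieldType) (r m : nat) (Gt : groupType)
    (p : Gt -> 'M[F]_r) (iota : F -> Gt) : Prop := IsCentralExtension {
  cover_proj_unit : forall g, p g \in unitmx;
  cover_projM : forall g h, p (g * h)%g = p g *m p h;
  cover_proj_surj : forall A, A \in unitmx -> exists g, p g = A;
  cover_iotaM : forall z w, m.-unity_root z -> m.-unity_root w ->
    iota (z * w) = (iota z * iota w)%g;
  cover_iota_inj : forall z w, m.-unity_root z -> m.-unity_root w ->
    iota z = iota w -> z = w;
  cover_ker : forall g,
    p g = 1%:M <-> exists2 z, m.-unity_root z & g = iota z;
  cover_central : forall z g, m.-unity_root z ->
    (iota z * g = g * iota z)%g }.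

(** A cover with kernel mu_m, of essential degree n, attached to B_{c,d}: the
    form enters through the commutator pairing on the torus.  For central
    commutators the conventions x^-1 y^-1 x y and x y x^-1 y^-1 agree. *)
Record is_metaplectic_cover (F : fieldType) (hilb : F -> F -> F)
    (r n m : nat) (c d : int) (Gt : groupType)
    (p : Gt -> 'M[F]_r) (iota : F -> Gt) : Prop := IsMetaplecticCover {
  cover_deg_gt0 : (0 < m)%N;
  cover_deg_dvd : (n %| m)%N;
  cover_roots : has_unity_roots F m;
  cover_ext : is_central_extension m p iota;
  cover_comm : forall (g h : Gt) (lambda mu : 'cV[int]_r) (x y : F),
    x != 0 -> y != 0 -> p g = cochar lambda x -> p h = cochar mu y ->
    [~ g, h]%g = iota (hilb x y ^ Bform c d lambda mu) }.

Definition torus_cover (F : fieldType) (r : nat) (Gt : groupType)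
    (p : Gt -> 'M[F]_r) : set Gt :=
  [set g | is_diag_mx (p g)].

Definition int_torus_cover (F : fieldType) (v : F -> int) (r : nat)
    (Gt : groupType) (p : Gt -> 'M[F]_r) : set Gt :=
  [set g | is_diag_mx (p g) /\ forall i, unit_int v (p g i i)].

Definition is_subgroup (Gt : groupType) (H : set Gt) : Prop :=
  [/\ H 1%g, forall g h, H g -> H h -> H (g * h)%g
    & forall g, H g -> H g^-1%g].

Definition is_abelian (Gt : groupType) (H : set Gt) : Prop :=
  forall g h, H g -> H h -> (g * h = h * g)%g.

Definition is_maximal_abelian (Gt : groupType) (T H : set Gt) : Prop :=
  [/\ is_subgroup H, H `<=` T, is_abelian H
    & forall K : set Gt, is_subgroup K -> K `<=` T -> is_abelian K ->
        H `<=` K -> K `<=` H].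

Definition left_cosets (Gt : groupType) (T H : set Gt) : set (set Gt) :=
  [set C | exists2 t, T t & C = [set g | H (t^-1 * g)%g]].

(* Main.v *)
(** Every torus element is a lift of pi^lambda times a unit torus element, and
    unit torus elements commute by hypothesis, so g lies in the maximal abelian
    H iff (pi, u)^B(lambda, e_j) = 1 for all units u and all j.  The key claim
    is that this forces n | k for k = B(lambda, e_j).  Since also (w, u)^k = 1
    for units w, the class of u^k pairs trivially with all of F^*, hence u^k is
    in F^*^n by surjectivity of the Artin map on a Kummer extension splitting
    X^n - u.  As mu_n is contained in F, for j = n / gcd(n, k) every unit is then
    a j-th power, which is impossible for j > 1: if l | j is the residue
    characteristic, 1 + pi is not an l-th power modulo pi^2, and otherwise l-th
    powering is not injective, hence not onto, on the units of the residue
    field.  So T/H is Z^r modulo the radical of B mod n. *)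
From HB Require Import structures.
Require Import Defs.
From mathcomp Require Import all_boot all_order all_algebra.
From mathcomp Require Import all_fingroup all_solvable all_field.
From mathcomp Require Import boolp classical_sets functions cardinality.
From mathcomp Require Import zify ring.

Import Order.TTheory GRing.Theory Num.Theory.
Local Open Scope ring_scope.
Local Open Scope classical_set_scope.

Set Implicit Arguments.
Unset Strict Implicit.
Unset Printing Implicit Defensive.

(** * Valuations *)

Section Valuation.
Variables (F : fieldType) (v : F -> int).
Hypothesis hv : is_discrete_valuation v.

Lemma valuationM x y : x != 0 -> y != 0 -> v (x * y) = v x + v y.
Proof. by case: hv => h _ _; exact: h. Qed.

Lemma vgeD k x y : vge v k x -> vge v k y -> vge v k (x + y).
Proof. by case: hv => _ h _; exact: h. Qed.

Lemma valuation1 : v 1 = 0.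
Proof.
have := valuationM (oner_neq0 F) (oner_neq0 F); rewrite mulr1 => h.
by apply: (addrI (v 1)); rewrite addr0 -h.
Qed.

Lemma valuationN1 : v (- 1) = 0.
Proof.
have n0 : -1 != 0 :> F by rewrite oppr_eq0 oner_eq0.
have := valuationM n0 n0; rewrite mulrNN mulr1 valuation1; lia.
Qed.

Lemma valuationX x k : x != 0 -> v (x ^+ k) = v x *+ k.
Proof.
move=> x0; elim: k => [|k IH]; first by rewrite expr0 mulr0n valuation1.
by rewrite exprS valuationM ?expf_neq0 // IH mulrS.
Qed.

Lemma valuationV x : x != 0 -> v x^-1 = - v x.
Proof.
move=> x0; have := valuationM x0 (_ : x^-1 != 0); rewrite invr_eq0 x0 => /(_ isT).
rewrite divff // valuation1 => /eqP; rewrite eq_sym addrC addr_eq0 => /eqP ->; by [].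
Qed.

Lemma valuationXz x (k : int) : x != 0 -> v (x ^ k) = v x * k.
Proof.
move=> x0; case: (intP k) => [|j|j].
- by rewrite expr0z valuation1 mulr0.
- by rewrite -exprnP valuationX // -mulr_natr natz.
- rewrite -invr_expz -exprnP valuationV ?expf_neq0 // valuationX //.
  by rewrite -mulr_natr natz mulrN.
Qed.

Lemma vge0 k : vge v k 0.
Proof. by rewrite /vge eqxx. Qed.

Lemma vge1 : vge v 0 1.
Proof. by rewrite /vge valuation1 lexx orbT. Qed.

Lemma vgeM j k x y : vge v j x -> vge v k y -> vge v (j + k) (x * y).
Proof.
rewrite /vge; have [->|x0] := eqVneq x 0; first by rewrite mul0r eqxx.
have [->|y0] /= := eqVneq y 0; first by rewrite mulr0 eqxx.
by rewrite mulf_eq0 (negPf x0) (negPf y0) /= valuationM //; exact: lerD.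
Qed.

Lemma vgeM0l k x y : vge v 0 x -> vge v k y -> vge v k (x * y).
Proof. by move=> hx /(vgeM hx); rewrite add0r. Qed.

Lemma vgeM0r k x y : vge v k x -> vge v 0 y -> vge v k (x * y).
Proof. by move=> hx /(vgeM hx); rewrite addr0. Qed.

Lemma vgeN k x : vge v k x -> vge v k (- x).
Proof.
by move=> hx; rewrite -mulN1r vgeM0l // /vge valuationN1 lexx orbT.
Qed.

Lemma vgeB k x y : vge v k x -> vge v k y -> vge v k (x - y).
Proof. by move=> hx /vgeN; exact: vgeD. Qed.

Lemma vgeB_sym k x y : vge v k (x - y) -> vge v k (y - x).
Proof. by move=> /vgeN; rewrite opprB. Qed.

Lemma vgeB_trans k y x z : vge v k (x - y) -> vge v k (y - z) -> vge v k (x - z).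
Proof. by move=> h1 /(vgeD h1); rewrite addrA subrK. Qed.

Lemma vge_le j k x : (j <= k)%R -> vge v k x -> vge v j x.
Proof. by rewrite /vge => jk /orP[->//|/(le_trans jk) ->]; rewrite orbT. Qed.

Lemma vgeX k x : vge v 0 x -> vge v 0 (x ^+ k).
Proof.
move=> hx; elim: k => [|k IH]; first by rewrite expr0 vge1.
by rewrite exprS vgeM0l.
Qed.

Lemma vge_nat k : vge v 0 k%:R.
Proof. by elim: k => [|k IH]; rewrite ?vge0 // mulrS vgeD ?vge1. Qed.

Lemma vge_sum (I : eqType) (s : seq I) (f : I -> F) k :
  (forall i, i \in s -> vge v k (f i)) -> vge v k (\sum_(i <- s) f i).
Proof.
elim: s => [|i s IH] h; first by rewrite big_nil vge0.
rewrite big_cons vgeD ?h ?mem_head ?IH // => j js; apply: h.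
by rewrite inE js orbT.
Qed.

Lemma vge_congX x y k : vge v 0 x -> vge v 0 y -> vge v 1 (x - y) ->
  vge v 1 (x ^+ k - y ^+ k).
Proof.
move=> hx hy h; rewrite subrXX vgeM0r // vge_sum // => i _.
by rewrite vgeM0l ?vgeX.
Qed.

Lemma unit_intX x k : unit_int v x -> unit_int v (x ^+ k).
Proof. by move=> [x0 hx]; split; rewrite ?expf_neq0 // valuationX // hx mul0rn. Qed.

Lemma unit_int_root x k : (0 < k)%N -> unit_int v (x ^+ k) -> unit_int v x.
Proof.
move=> k0 [xk0 hx]; have x0 : x != 0 by move: xk0; rewrite expf_eq0 k0.
split=> //; move: hx; rewrite valuationX // => /eqP.
by rewrite mulrn_eq0 eqn0Ngt k0 => /eqP.
Qed.

Lemma unit_int_vge x : unit_int v x -> vge v 0 x.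
Proof. by move=> [_ hx]; rewrite /vge hx lexx orbT. Qed.

Lemma unit_int_nvge x : unit_int v x -> ~~ vge v 1 x.
Proof. by move=> [x0 hx]; rewrite /vge negb_or x0 hx. Qed.

Lemma nvge_unit_int x : vge v 0 x -> ~~ vge v 1 x -> unit_int v x.
Proof.
rewrite /vge; have [//|x0] /= := eqVneq x 0; rewrite -ltNge => h1 h2.
split=> //; apply/eqP; rewrite eq_le; apply/andP; split=> //; lia.
Qed.

Lemma unit_int_cong x y : unit_int v x -> vge v 1 (x - y) -> unit_int v y.
Proof.
move=> ux h; apply: nvge_unit_int.
  by rewrite -[y](subKr x); apply: vgeB; [exact: unit_int_vge | exact: vge_le h].
apply: contra (unit_int_nvge ux) => hy; by rewrite -[x](subrK y) vgeD.
Qed.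

(** * Units that are not l-th powers, and divisibility of exponents *)

Lemma exprD1_prime (l : nat) (y : F) : prime l -> vge v 0 y ->
  exists2 w, vge v 0 w & (1 + y) ^+ l = 1 + y ^+ l + l%:R * y * w.
Proof.
case: l => [|[|l]] // hl hy.
(* The prime is now [l.+2] and divides every inner binomial coefficient; taking out [l.+2] and one
   factor [y] shifts the index by one. *)
exists (\sum_(i < l.+1) ('C(l.+2, i.+1) %/ l.+2)%:R * y ^+ i).
  by apply: vge_sum => i _; rewrite vgeM0l ?vge_nat ?vgeX.
rewrite exprDn big_ord_recl big_ord_recr /= subn0 expr1n expr0 mulr1 bin0 mulr1n.
rewrite /bump /= subnn expr0 mul1r binn mulr1n -addrA; congr (_ + _).
rewrite addrC; congr (_ + _); rewrite mulr_sumr; apply: eq_bigr => i _.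
rewrite expr1n mul1r add1n -mulr_natl exprS -{1}(divnK (_ : (l.+2 %| 'C(l.+2, i.+1))%N)).
  by rewrite natrM; ring.
by apply: prime_dvd_bin => //; exact: (ltn_ord i).
Qed.

(** The case split is on whether [l] is the residue characteristic, that is, whether [l%:R] lies in
    the maximal ideal. *)
Lemma nonpower_unit (q l : nat) (z : F) :
  residue_card v q -> prime l -> l.-primitive_root z ->
  exists2 u, unit_int v u & forall x, x ^+ l <> u.
Proof.
move=> [s [[us _] hs0 hs1 hs2]] hl hz.
have l0 : (0 < l)%N := prime_gt0 hl.
apply: contrapT => hN.
have pw u : unit_int v u -> exists2 x, unit_int v x & x ^+ l = u.
  move=> uu; have [x hx] : exists x, x ^+ l = u.
    apply: contrapT => h; apply: hN; exists u => // x hx; by apply: h; exists x.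
  by exists x => //; apply: (@unit_int_root _ l) => //; rewrite hx.
have [pi pi0 vpi] : exists2 x, x != 0 & v x = 1 by case: hv.
case: (boolP (vge v 1 l%:R)) => [hl1|hl1].
  (* 1 + pi is not an l-th power modulo pi^2 *)
  have [x ux hx] : exists2 x, unit_int v x & x ^+ l = 1 + pi.
    apply: pw; apply: (@unit_int_cong 1); first by split; rewrite ?oner_eq0 ?valuation1.
    by rewrite opprD addrA subrr sub0r vgeN // /vge vpi lexx orbT.
  have hy : vge v 0 (x - 1) by exact: vgeB (unit_int_vge ux) vge1.
  have [w hw] := exprD1_prime hl hy.
  rewrite addrC subrK hx -addrA => /addrI Epi.
  (* With y = [x - 1], [Epi] reads pi = y^l + l y w. So y^l, and then y, lies in the maximal ideal,
     and both summands have valuation at least 2. *)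
  have yl : vge v 1 ((x - 1) ^+ l).
    have -> : (x - 1) ^+ l = pi - l%:R * (x - 1) * w by rewrite Epi addrK.
    by rewrite vgeB ?vgeM0r // /vge vpi lexx orbT.
  have y1 : vge v 1 (x - 1).
    apply: contraT => hn; have := nvge_unit_int hy hn.
    by move=> /(@unit_intX _ l)/unit_int_nvge; rewrite yl.
  have : vge v 2 pi.
    rewrite Epi vgeD //; last by rewrite vgeM0r // (vgeM hl1 y1).
    case: (l) (prime_gt1 hl) => [|[|k]] // _; rewrite !exprS mulrA vgeM0r //.
      exact: (vgeM y1 y1).
    by rewrite vgeX.
  by rewrite /vge (negPf pi0) vpi.
have ul : unit_int v l%:R by apply: nvge_unit_int; rewrite ?vge_nat.
have uz : unit_int v z.
  apply: (@unit_int_root _ l) => //; rewrite (prim_expr_order hz).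
  by split; rewrite ?oner_eq0 ?valuation1.
(* If [z] were 1 modulo the maximal ideal, the vanishing sum 1 + z + ... + z^(l-1) would be
   congruent to [l%:R]. *)
have z1 : ~~ vge v 1 (z - 1).
  apply: contra hl1 => h.
  have E : \sum_(i < l) z ^+ i = 0.
    have := subrX1 z l; rewrite (prim_expr_order hz) subrr => /esym/eqP.
    rewrite mulf_eq0 subr_eq0 => /orP[/eqP z1|/eqP //].
    have := prim_order_dvd hz 1; rewrite expr1 z1 eqxx dvdn1 => /eqP l1.
    by move: hl; rewrite l1.
  have -> : l%:R = - \sum_(i < l) (z ^+ i - 1) :> F.
    by rewrite sumrB E sumr_const card_ord sub0r opprK.
  rewrite vgeN // vge_sum // => i _; rewrite -[X in _ - X](expr1n _ i).
  by rewrite vge_congX ?vge1 ?unit_int_vge.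
(* otherwise x |-> x^l would be onto, hence injective, on residue units,
   although it identifies 1 and z *)
pose U := [seq a <- s | ~~ vge v 1 a].
have uU a : a \in U -> unit_int v a.
  by rewrite mem_filter => /andP[h1 h2]; apply: nvge_unit_int => //; apply: hs0.
have rep x : unit_int v x -> exists2 a, a \in U & vge v 1 (x - a).
  move=> ux; have [a ha hxa] := hs2 x (unit_int_vge ux); exists a => //.
  by rewrite mem_filter ha andbT unit_int_nvge //; apply: unit_int_cong hxa.
(* [f] sends the representative of a unit class to that of an l-th root of the class; the value 0
   off [U] is a dummy. *)
have /boolp.choice[f hf] a : exists b, a \in U ->
    b \in U /\ vge v 1 (b ^+ l - a).
  case: (boolP (a \in U)) => [aU|_]; last by exists 0.
  have [x ux <-] := pw a (uU a aU); have [b bU hb] := rep x ux; exists b => _.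
  split=> //; apply: vge_congX; [exact/unit_int_vge/uU | exact: unit_int_vge |].
  exact: vgeB_sym.
have injf : {in U &, injective f}.
  move=> a b aU bU E; apply: hs1.
  - by move: aU; rewrite mem_filter => /andP[].
  - by move: bU; rewrite mem_filter => /andP[].
  have [_ ha] := hf a aU; have [_ hb] := hf b bU.
  by apply: (vgeB_trans (y := f a ^+ l)); [exact: vgeB_sym | rewrite E].
have uniqfU : uniq [seq f a | a <- U] by rewrite map_inj_in_uniq ?filter_uniq.
have subfU : {subset [seq f a | a <- U] <= U}.
  by move=> _ /mapP[a aU ->]; have [] := hf a aU.
(* An injection of a finite list into itself is onto. *)
have [_ memfU] := uniq_min_size uniqfU subfU (eq_leq (esym (size_map f U))).
have u1 : unit_int v 1 by split; rewrite ?oner_eq0 ?valuation1.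
(* The class of such an [x] is that of [f a] for the representative [a] of 1, so 1 and [z] fall into
   the same class. *)
have root1 x : unit_int v x -> x ^+ l = 1 ->
    exists a, [/\ a \in U, vge v 1 (x - f a) & vge v 1 (1 - a)].
  move=> ux x1; have [b bU hb] := rep x ux; have ub := uU b bU.
  move: bU; rewrite -memfU => /mapP[a aU Eb]; exists a; split=> //; first by rewrite -Eb.
  have [fU ha] := hf a aU; apply: vgeB_trans ha.
  by rewrite -x1; apply: vge_congX; rewrite -?Eb //; exact: unit_int_vge.
have [a [aU ha a1]] := root1 1 u1 (expr1n _ _).
have [b [bU hb b1]] := root1 z uz (prim_expr_order hz).
have ab : a = b.
  apply: hs1.
  - by move: aU; rewrite mem_filter => /andP[].
  - by move: bU; rewrite mem_filter => /andP[].
  exact: vgeB_trans (vgeB_sym a1) b1.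
move/negP: z1; apply; rewrite ab in ha.
exact: vgeB_trans hb (vgeB_sym ha).
Qed.

(** Write n = j h and k = k' h with h = gcd(n, k). Then u^k' is a j-th power times an h-th root of
    unity, itself a j-th power of a power of [z], and Bezout makes every unit u a j-th power. A
    prime divisor of j would contradict [nonpower_unit]. *)
Lemma dvdn_of_unit_powers (q n k : nat) (z : F) :
  residue_card v q -> (0 < n)%N -> n.-primitive_root z ->
  (forall u, unit_int v u -> exists y, u ^+ k = y ^+ n) -> (n %| k)%N.
Proof.
move=> hq n0 hz hk; pose h := gcdn n k.
have h0 : (0 < h)%N by rewrite gcdn_gt0 n0.
have [j En] : exists j, n = (j * h)%N by apply/dvdnP; exact: dvdn_gcdl.
have [k' Ek] : exists k', k = (k' * h)%N by apply/dvdnP; exact: dvdn_gcdr.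
have cop : coprime j k'.
  by rewrite /coprime -(eqn_pmul2r h0) muln_gcdl -En -Ek mul1n.
have [j1|j1] := leqP j 1.
  have -> : n = h by rewrite En; case: j j1 En {cop} n0 => [|[|]] // _ ->; rewrite ?mul1n.
  exact: dvdn_gcdr.
have j0 : (0 < j)%N := ltnW j1.
have root u : unit_int v u -> exists x, x ^+ j = u.
  move=> uu; have [y] := hk u uu.
  rewrite Ek En !exprM => E.
  have y0 : y != 0.
    apply: contra_eq_neq E => ->; rewrite !expr0n.
    by rewrite (gtn_eqF j0) expr0n (gtn_eqF h0) !expf_neq0 //; case: uu.
  have [u0 _] := uu.
  have [i Ei] : exists i : nat, u ^+ k' / y ^+ j = (z ^+ i) ^+ j.
    have hzj : h.-primitive_root (z ^+ j).
      have := dvdn_prim_root hz (_ : (h %| n)%N); rewrite En mulnK //; apply.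
      by rewrite dvdn_mull.
    have /(prim_rootP hzj)[i ->] : (u ^+ k' / y ^+ j) ^+ h = 1.
      by rewrite exprMn exprVn E divff // !expf_neq0.
    by exists i; rewrite -!exprM mulnC.
  have {}E : u ^+ k' = (z ^+ i * y) ^+ j.
    by rewrite exprMn -Ei mulfVK // expf_neq0.
  (* Bezout gives a j = b k' + 1, so the j-th power of the witness is u^(a j) / u^(b k') = u. *)
  case: (egcdnP k' j0) => a b; rewrite (eqP cop) addn1 => Eab _.
  exists (u ^+ a / (z ^+ i * y) ^+ b).
  rewrite exprMn exprVn -!exprM Eab mulnC [(b * j)%N]mulnC !exprM -E -exprM.
  by rewrite mulnC exprS mulfK // expf_neq0.
have [l hl lj] : exists2 l, prime l & (l %| j)%N.
  by exists (pdiv j); [exact: pdiv_prime | exact: pdiv_dvd].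
have ln : (l %| n)%N by rewrite En dvdn_mulr.
have [u uu] := nonpower_unit hq hl (dvdn_prim_root hz ln).
have [x <-] := root u uu.
by move/(_ (x ^+ (j %/ l))); rewrite -exprM divnK.
Qed.
End Valuation.

(** * Kummer extensions and the radical of the Hilbert symbol *)

Lemma irreducible_factor (F : fieldType) (p : {poly F}) :
  (1 < size p)%N -> exists2 q, irreducible_poly q & q %| p.
Proof.
have [k] := ubnP (size p); elim: k p => // k IH p szp p1.
have [ip|nip] := pselect (irreducible_poly p); first by exists p.
apply: contrapT => hN; apply: nip; split=> // q q1 qp.
have p0 : p != 0 by apply: contraTneq p1 => ->; rewrite size_poly0.
have q0 : q != 0 by apply: contraTneq qp => ->; rewrite dvd0p.
apply: contrapT => /negP nqp; apply: hN.
have sq : (size q < size p)%N.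
  by rewrite ltn_neqAle dvdp_size_eqp // nqp dvdp_leq.
have [||s irs sq'] := IH q.
- exact: leq_trans sq szp.
- by move: q0 q1; rewrite -size_poly_gt0; case: (size q) => [|[]].
- by exists s => //; apply: dvdp_trans qp.
Qed.

(** A root b of one irreducible factor of X^n - u suffices: the roots are the z^i b with z in F, so
    F(b) is a splitting field, and automorphisms commute because each scales b by an element of
    F. *)
Lemma kummer_extension (F : fieldType) (n : nat) (z u : F) :
  (0 < n)%N -> n.-primitive_root z -> u != 0 ->
  exists (L : splittingFieldType F) (b : L), abelian_ext L /\ b ^+ n = u%:A.
Proof.
move=> n0 hz u0.
have [|q irq qp] := @irreducible_factor F ('X^n - u%:P).
  by rewrite size_XnsubC // ltnS.
have [L0 _ [b rb gb]] := irredp_FAdjoin irq.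
have bn : b ^+ n = u%:A.
  have : root (map_poly (in_alg L0) ('X^n - u%:P)) b.
    by case/dvdpP: qp => f ->; rewrite rmorphM rootM rb orbT.
  by rewrite rmorphB /= map_polyXn map_polyC /= rootE !hornerE subr_eq0 => /eqP.
have b0 : b != 0.
  apply: contra_eq_neq bn => ->; rewrite expr0n (gtn_eqF n0) eq_sym.
  by rewrite scaler_eq0 negb_or u0 oner_neq0.
have hzL : n.-primitive_root (in_alg L0 z) by rewrite fmorph_primitive_root.
pose r := [seq (in_alg L0 z) ^+ i * b | i <- iota 0 n].
pose p := 'X^n - (u%:A)%:P : {poly L0}.
have ur : uniq r.
  rewrite map_inj_in_uniq ?iota_uniq // => i j.
  rewrite !mem_iota !add0n /= => li lj /(mulIf b0)/eqP.
  by rewrite (eq_prim_root_expr hzL) !modn_small // => /eqP.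
have Ep : p = \prod_(x <- r) ('X - x%:P).
  rewrite [LHS](@all_roots_prod_XsubC _ _ r).
  - by rewrite (monicP _) ?scale1r ?monicXnsubC.
  - by rewrite size_XnsubC // size_map size_iota.
  - apply/allP => _ /mapP[i _ ->]; rewrite rootE !hornerE exprMn -exprM mulnC exprM.
    by rewrite (prim_expr_order hzL) expr1n mul1r bn subrr.
  - by rewrite uniq_rootsE.
have pF : p \is a polyOver 1%VS.
  by rewrite rpredB ?rpredX ?polyOverX // polyOverC rpredZ // rpred1.
have sp : splittingFieldFor 1 p {:L0}.
  exists r; first by rewrite Ep eqpxx.
  apply/eqP; rewrite eqEsubv subvf -gb; apply/FadjoinP; split.
    exact: subv_adjoin_seq.
  apply: seqv_sub_adjoin; apply/mapP; exists 0%N; first by rewrite mem_iota.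
  by rewrite expr0 mul1r.
have ax : splitting_field_axiom L0 by exists p.
pose Lm := FieldExt_isSplittingField.Build F L0 ax.
pose L : splittingFieldType F := HB.pack L0 Lm.
exists L, b; split=> //; split.
  apply/splitting_galoisField; exists p; split=> //.
  by rewrite Ep separable_prod_XsubC.
have galb (s : gal_of {:L}) : exists i, s (b : L) = (in_alg L z) ^+ i * b.
  have : root p (s b).
    by rewrite rootE !hornerE -rmorphXn /= bn linearZ /= rmorph1 subrr.
  by rewrite Ep root_prod_XsubC => /mapP[i _ ->]; exists i.
have fixz (s : gal_of {:L}) i : s (in_alg L z ^+ i) = in_alg L z ^+ i.
  by rewrite rmorphXn /= linearZ /= rmorph1.
apply/centsP => s _ t _; rewrite /commute.
apply/eqP/gal_eqP => x _.
(* An element of F(b) is a polynomial in b over F, so comparing values at b is enough. *)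
have: x \in <<1; (b : L)>>%VS by rewrite [<<1; _>>%VS]gb memvf.
move=> /Fadjoin_polyP[f fF ->].
have galf (s' : gal_of {:L}) y : s' f.[y] = f.[s' y].
  rewrite -horner_map; congr (_.[_]).
  apply/polyP => i; rewrite coef_map /=.
  by have /vlineP[a ->] := polyOverP fF i; rewrite linearZ /= rmorph1.
have [i Ei] := galb s; have [j Ej] := galb t.
rewrite !galM ?memvf // !galf Ei Ej !rmorphM /= !fixz Ei Ej.
by rewrite mulrCA.
Qed.
(** Art(x) scales b = u^(1/n) by (x, u), so by surjectivity of the Artin map b^k is fixed by the
    Galois group. Hence b^k lies in F, and its n-th power is u^k. *)
Lemma hilbert_radical (F : fieldType) (v : F -> int) (n k : nat) (z u : F)
    (hilb : F -> F -> F) : (0 < n)%N -> n.-primitive_root z ->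
  is_hilbert_symbol v n hilb -> u != 0 ->
  (forall x, x != 0 -> hilb x u ^+ k = 1) -> exists y, u ^+ k = y ^+ n.
Proof.
move=> n0 hz [artin hart hh] u0 hk.
have [L [b [abL bn]]] := kummer_extension n0 hz u0.
have : b ^+ k \in fixedField 'Gal({:L} / 1)%g.
  apply/fixedFieldP => [|s _]; first exact: memvf.
  have [x x0 <-] := artin_surj hart abL s.
  rewrite rmorphXn /= (hh x u x0 u0 L b abL bn) exprMn exprZn hk //.
  by rewrite expr1n scale1r mul1r.
case: (abL) => /galois_fixedField -> _ /vlineP[y Ey]; exists y.
apply: (fmorph_inj (in_alg L)); rewrite !rmorphXn /= -Ey -bn.
by rewrite -!exprM mulnC.
Qed.

(** Both properties are read off from Art(x) scaling u^(1/n): the n-th power u is fixed, and the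
    scaling factors lie in F, so automorphisms fix them and they multiply. *)
Lemma hilbert_symbol_morph (F : fieldType) (v : F -> int) (n : nat) (z u : F)
    (hilb : F -> F -> F) : (0 < n)%N -> n.-primitive_root z ->
  is_hilbert_symbol v n hilb -> u != 0 ->
  (forall x, x != 0 -> hilb x u ^+ n = 1) /\
  (forall x y, x != 0 -> y != 0 -> hilb (x * y) u = hilb x u * hilb y u).
Proof.
move=> n0 hz [artin hart hh] u0.
have [L [b [abL bn]]] := kummer_extension n0 hz u0.
have b0 : b != 0.
  apply: contra_eq_neq bn => ->; rewrite expr0n (gtn_eqF n0) eq_sym.
  by rewrite scaler_eq0 negb_or u0 oner_neq0.
have H x (x0 : x != 0) := hh x u x0 u0 L b abL bn.
have algI : injective (in_alg L) by exact: fmorph_inj.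
split=> [x x0|x y x0 y0]; apply: algI.
  have bn0 : b ^+ n != 0 by rewrite expf_neq0.
  apply: (mulIf bn0); rewrite rmorphXn /= -exprMn -H // -rmorphXn /= bn.
  by rewrite linearZ /= rmorph1 scale1r mul1r.
apply: (mulIf b0); rewrite /= -[LHS]H ?mulf_neq0 //.
rewrite (artinM hart abL x0 y0) galM ?memvf // H // rmorphM /= linearZ /= rmorph1.
by rewrite H // -!scalerAl !mul1r scalerA.
Qed.

(** * The form B_{c,d} modulo n *)

Section Form.
Variables (r : nat) (c d : int).
Local Notation B := (Bform c d).
Local Notation e i := (delta_mx i 0 : 'cV[int]_r).
Implicit Types x y : 'cV[int]_r.

Lemma BformBl x x' y : B (x - x') y = B x y - B x' y.
Proof. by rewrite /Bform linearB /= !mulmxBl !mxE. Qed.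

Lemma Bform_suml x y : B x y = \sum_i x i 0 * B (e i) y.
Proof.
rewrite {1}/Bform [x in x^T]matrix_sum_delta linear_sum /= !mulmx_suml summxE.
apply: eq_bigr => i _; rewrite big_ord1 linearZ /= -!scalemxAl mxE.
by rewrite trmx_delta /Bform trmx_delta.
Qed.

Lemma Bform_sumr x y : B x y = \sum_j y j 0 * B x (e j).
Proof.
rewrite {1}/Bform [y in _ *m y]matrix_sum_delta mulmx_sumr summxE.
by apply: eq_bigr => i _; rewrite big_ord1 -!scalemxAr mxE.
Qed.

Variable n : nat.

(** Testing on the basis keeps the predicate boolean; by [in_radicalP] this is the radical modulo n
    of the form on Z^r. *)
Definition in_radical x : bool := [forall j, (n%:Z %| B x (e j))%Z].

Lemma in_radicalP x : reflect (forall y, (n%:Z %| B x y)%Z) (in_radical x).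
Proof.
apply: (iffP forallP) => h y //; rewrite Bform_sumr.
by apply: rpred_sum => j _; rewrite dvdz_mull.
Qed.

Lemma in_radicalB x y : in_radical x -> in_radical y -> in_radical (x - y).
Proof.
move=> /forallP hx /forallP hy; apply/forallP => j.
by rewrite BformBl rpredB.
Qed.

Lemma in_radical0 : in_radical 0.
Proof. by apply/forallP => j; rewrite /Bform trmx0 !mul0mx mxE dvdz0. Qed.

Lemma in_radical_cong x y : (forall i, (n%:Z %| (x i 0 - y i 0)%R)%Z) ->
  in_radical (x - y).
Proof.
move=> h; apply/forallP => j; rewrite Bform_suml.
by apply: rpred_sum => i _; rewrite dvdz_mulr // !mxE.
Qed.

Lemma in_radical_eq x y : in_radical (x - y) -> in_radical x = in_radical y.
Proof.
move=> h; apply/idP/idP => k.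
  by rewrite -[y](subKr x) in_radicalB.
have -> : x = (x - y) - (0 - y) by rewrite sub0r opprK subrK.
  by apply: (in_radicalB h); apply: in_radicalB k; exact: in_radical0.
Qed.

End Form.

(** * Counting the image and the radical of the form on (Z/n)^r *)

Section Count.
Variables (r n' : nat) (c d : int).
Local Notation n := n'.+1.
Local Notation B := (Bform c d).
Local Notation e i := (delta_mx i 0 : 'cV[int]_r).

(** This is x -> A x mod n, the matrix A of the form being symmetric; its kernel is the radical, so
    its values can index the cosets of H. *)
Definition residues (x : 'cV[int]_r) : {ffun 'I_r -> 'I_n} :=
  [ffun j => inord `|(B x (e j) %% n)%Z|%N].

Lemma residuesP x y : residues x = residues y <-> in_radical c d n (x - y).
Proof.
split=> [/ffunP h|/forallP h].
  apply/forallP => j; rewrite BformBl -eqz_mod_dvd.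
  have := congr1 val (h j); rewrite !ffunE /= !inordK.
  - move/(congr1 Posz); rewrite !gez0_abs ?modz_ge0 //; by move=> ->.
  - by rewrite -ltz_nat gez0_abs ?modz_ge0 ?ltz_pmod.
  - by rewrite -ltz_nat gez0_abs ?modz_ge0 ?ltz_pmod.
apply/ffunP => j; rewrite !ffunE; have := h j.
by rewrite BformBl -eqz_mod_dvd => /eqP ->.
Qed.

Lemma mem_Bradical (x : {ffun 'I_r -> 'I_n}) :
  (x \in Bradical r n c d) = in_radical c d n (lift_Zn x).
Proof.
rewrite inE; apply/forallP/forallP => h => [j|y]; last first.
  by apply/in_radicalP/forallP.
(* For n = 1 the entry 1 of a basis vector has no representative in ['I_n], but divisibility is
   automatic; for n > 1 basis vectors are lifts. *)
have [n0|n0] := posnP n'; first by rewrite [X in dvdz X](_ : _ = 1) ?dvd1z // n0.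
have := h [ffun i => inord (i == j)].
congr ((_ %| B _ _)%Z); apply/matrixP => i k; rewrite !mxE ord1 ffunE eqxx andbT.
by rewrite inordK //; case: (i == j).
Qed.

Lemma residues_lift (x : 'cV[int]_r) :
  exists y : {ffun 'I_r -> 'I_n}, residues x = residues (lift_Zn y).
Proof.
exists [ffun i => inord `|((x i 0)%R %% n)%Z|%N].
apply/residuesP/in_radical_cong => i; rewrite mxE ffunE inordK.
  by rewrite gez0_abs ?modz_ge0 // -eqz_mod_dvd modz_mod.
by rewrite -ltz_nat gez0_abs ?modz_ge0 ?ltz_pmod.
Qed.

Definition residue_image : {set {ffun 'I_r -> 'I_n}} :=
  [set residues (lift_Zn y) | y in [set: {ffun 'I_r -> 'I_n}]]%SET.

Lemma lift_ZnB (x y : {ffun 'I_r -> 'I_n}) i :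
  (n%:Z %| (lift_Zn (x - y) i 0 - (lift_Zn x - lift_Zn y) i 0)%R)%Z.
Proof.
rewrite !mxE !ffunE /= -eqz_mod_dvd.
rewrite modnDmr -modz_nat modz_mod PoszD -subzn; last exact/ltnW/ltn_ord.
by rewrite addrCA modzDl.
Qed.

(** On (Z/n)^r the fibre of the residue map through y is y + radical, so all fibres have the size of
    the radical. *)
Lemma card_residue_image :
  (#|residue_image| * #|Bradical r n c d| = n ^ r)%N.
Proof.
have -> : (n ^ r = #|[set: {ffun 'I_r -> 'I_n}]%SET|)%N.
  by rewrite cardsT card_ffun !card_ord.
rewrite -[RHS]sum1_card (partition_big_imset (fun y => residues (lift_Zn y))) /=.
rewrite -sum_nat_const; apply: eq_bigr => _ /imsetP[y _ ->].
rewrite -(card_imset _ (addrI y)) -sum1_card; apply: eq_bigl => x.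
rewrite inE /=; apply/imsetP/eqP => [[w + ->]|/residuesP h].
  rewrite mem_Bradical => h; apply/residuesP.
  rewrite -(in_radical_eq (x := lift_Zn w)) //; apply: in_radical_cong => i.
  have := lift_ZnB (y + w) y i; by rewrite [y + w]addrC addrK.
exists (x - y); last by rewrite addrC subrK.
rewrite mem_Bradical (in_radical_eq (y := lift_Zn x - lift_Zn y)) //.
by apply: in_radical_cong => i; exact: lift_ZnB.
Qed.

End Count.

(** * The covering torus *)

Lemma expz_absz_eq1 (F : fieldType) (x : F) (k : int) :
  x ^ k = 1 -> x ^+ `|k|%N = 1.
Proof.
case: (intP k) => [|j|j]; rewrite ?expr0 // abszN.
by rewrite -invr_expz -exprnP => /(congr1 GRing.inv); rewrite invrK invr1.
Qed.

Lemma expz_dvd_eq1 (F : fieldType) (x : F) (n : nat) (k : int) :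
  x ^+ n = 1 -> (n%:Z %| k)%Z -> x ^ k = 1.
Proof.
by move=> xn /dvdzP[j ->]; rewrite mulrC -exprz_exp -exprnP xn exp1rz.
Qed.

Lemma expz_sum_eq1 (F : fieldType) (x : F) (I : finType) (a b : I -> int) :
  x != 0 -> (forall i, x ^ b i = 1) -> x ^ (\sum_i a i * b i) = 1.
Proof.
move=> x0 h; elim/big_ind: _ => [|k l hk hl|i _]; first by rewrite expr0z.
  by rewrite expfzDr // hk hl mulr1.
by rewrite mulrC -exprz_exp h exp1rz.
Qed.

Section Torus.
Variables (F : fieldType) (r m : nat) (Gt : groupType).
Variables (p : Gt -> 'M[F]_r) (iota : F -> Gt).
Hypothesis hext : is_central_extension m p iota.
Local Notation T := (torus_cover p).

Lemma torus_neq0 g i : T g -> p g i i != 0.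
Proof.
move=> Tg; have := cover_proj_unit hext g.
have /diag_mxP[d E] := Tg; rewrite E unitmxE det_diag unitfE => /prodf_neq0/(_ i isT).
by rewrite mxE eqxx mulr1n.
Qed.

Lemma cover_proj1 : p 1%g = 1%:M.
Proof.
have := cover_projM hext 1%g 1%g; rewrite mulg1 => E.
have u := cover_proj_unit hext 1%g.
by rewrite -[LHS](mulKmx u) -E mulVmx.
Qed.

Lemma iota1 : iota 1 = 1%g.
Proof.
have r1 : m.-unity_root (1 : F) by apply/unity_rootP; rewrite expr1n.
have := cover_iotaM hext r1 r1; rewrite mulr1 => /(congr1 (fun x => (iota 1)^-1 * x)%g).
by rewrite mulVg mulKg.
Qed.

Lemma torus_divE g h i j : T g -> T h -> p (g^-1 * h)%g i j = (p g i i)^-1 * p h i j.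
Proof.
move=> Tg Th; have := cover_projM hext g (g^-1 * h)%g; rewrite mulVKg => ->.
have gi := torus_neq0 i Tg; have /diag_mxP[d E] := Tg; move: gi; rewrite E.
by rewrite mul_diag_mx !mxE eqxx mulr1n => gi; rewrite mulKf.
Qed.

Lemma torus_div g h : T g -> T h -> T (g^-1 * h)%g.
Proof.
move=> Tg Th; apply/is_diag_mxP => i j ij; rewrite torus_divE //.
by have /is_diag_mxP -> := Th; rewrite ?mulr0.
Qed.

Lemma torus1 : T 1%g.
Proof. by rewrite /torus_cover /= cover_proj1 scalar_mx_is_diag. Qed.

Lemma torusV g : T g -> T g^-1%g.
Proof. by move=> Tg; rewrite -[X in T X]mulg1; apply: torus_div torus1. Qed.

Lemma torusM g h : T g -> T h -> T (g * h)%g.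
Proof. by move=> Tg Th; have := torus_div (torusV Tg) Th; rewrite invgK. Qed.

Lemma cochar_lift (lam : 'cV[int]_r) (x : F) : x != 0 ->
  exists2 g, p g = cochar lam x & T g.
Proof.
move=> x0; have [|g Eg] := cover_proj_surj hext (A := cochar lam x).
  rewrite unitmxE det_diag unitfE; apply/prodf_neq0 => i _.
  by rewrite mxE expfz_neq0.
by exists g => //; rewrite /torus_cover /= Eg diag_mx_is_diag.
Qed.

Lemma cocharE (lam : 'cV[int]_r) (x : F) i : cochar lam x i i = x ^ lam i 0.
Proof. by rewrite !mxE eqxx mulr1n. Qed.

Lemma ker_commute g h : p g = 1%:M -> commute g h.
Proof. by move=> /(cover_ker hext)[z hz ->]; exact: (cover_central hext). Qed.

(* The torus is generated by the kernel and the coordinate cocharacters. *)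
Lemma torus_commute (P : F -> Prop) (a : Gt) :
  (forall j h u, P u -> p h = cochar (delta_mx j 0) u -> commute a h) ->
  forall g, T g -> (forall i, P (p g i i)) -> commute a g.
Proof.
move=> ha.
(* Induct on a bound k for the indices of nontrivial diagonal entries: dividing by a lift [h] of the
   last entry lowers k, and k = 0 leaves an element of the kernel. *)
suff IH k : (k <= r)%N -> forall g, T g ->
    (forall i : 'I_r, (i < k)%N -> P (p g i i)) ->
    (forall i : 'I_r, (k <= i)%N -> p g i i = 1) -> commute a g.
  move=> g Tg hg; apply: (IH r) => // i.
  by rewrite leqNgt ltn_ord.
elim: k => [_ g Tg _ g1|k IH kr g Tg Pg g1].
  apply/commute_sym/ker_commute/matrixP => i j; rewrite mxE.
  have [<-|ij] := eqVneq; first by rewrite g1.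
  by have /is_diag_mxP -> := Tg.
pose j := Ordinal kr; have gj0 := torus_neq0 j Tg.
have [h Eh Th] := cochar_lift (delta_mx j 0) gj0.
have ah : commute a h by apply: (ha j h (p g j j)) => //; apply: Pg.
rewrite -[g](mulVKg h); apply: commuteM => //.
have E i : p h i i = p g j j ^ ((i == j) : nat)%:Z.
  by rewrite Eh cocharE mxE eqxx andbT natz.
apply: IH; [exact: ltnW | exact: torus_div | |] => i ik; rewrite torus_divE // E.
  have /negPf -> : i != j by apply: contraTneq ik => ->; rewrite ltnn.
  by rewrite expr0z invr1 mul1r; apply: Pg; rewrite ltnS ltnW.
have [->|ij] := eqVneq; first by rewrite expr1z mulVf.
rewrite expr0z invr1 mul1r; apply: g1; rewrite ltn_neqAle ik andbT.
by apply: contra ij => /eqP ki; apply/eqP/val_inj.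
Qed.

Section Weight.
Variable v : F -> int.
Hypothesis hv : is_discrete_valuation v.

(** On the torus this is a homomorphism onto the cocharacter lattice with kernel
    [int_torus_cover]. *)
Definition weight (g : Gt) : 'cV[int]_r := \col_i v (p g i i).

Lemma weight_div g h : T g -> T h -> weight (g^-1 * h)%g = weight h - weight g.
Proof.
move=> Tg Th; apply/matrixP => i k; rewrite !mxE torus_divE //.
by rewrite valuationM ?invr_eq0 ?torus_neq0 // valuationV ?torus_neq0 // addrC.
Qed.

Lemma weight_cochar g lam pi : pi != 0 -> v pi = 1 -> p g = cochar lam pi ->
  weight g = lam.
Proof.
move=> pi0 vpi Eg; apply/matrixP => i k.
by rewrite mxE Eg cocharE valuationXz // vpi mul1r ord1.
Qed.

Lemma torus_decomposition g pi : T g -> pi != 0 -> v pi = 1 ->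
  exists a b, [/\ g = (a * b)%g, p a = cochar (weight g) pi & int_torus_cover v p b].
Proof.
move=> Tg pi0 vpi; have [a Ea Ta] := cochar_lift (weight g) pi0.
exists a, (a^-1 * g)%g; split=> //; first by rewrite mulVKg.
have Tb := torus_div Ta Tg; split=> // i; split; first exact: torus_neq0.
have := weight_div Ta Tg; rewrite (weight_cochar pi0 vpi Ea) subrr.
by move/matrixP/(_ i 0); rewrite !mxE.
Qed.

End Weight.
End Torus.

(** * The maximal abelian subgroup *)

Lemma has_unity_roots_prim (F : fieldType) (k n : nat) :
  (0 < n)%N -> (0 < k)%N -> has_unity_roots F (k * n)%N ->
  exists z : F, n.-primitive_root z.
Proof.
move=> n0 k0 [s [us ss hs]].
have kn0 : (0 < k * n)%N by rewrite muln_gt0 k0.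
have /hasP[z _ hz] := has_prim_root kn0 hs us (eq_leq (esym ss)).
by exists (z ^+ (k * n %/ n)); apply: dvdn_prim_root hz _ _; rewrite dvdn_mull.
Qed.

Section Cover.
Variables (F : fieldType) (v : F -> int) (n r : nat) (c d : int).
Hypotheses (hF : is_local_field v) (n0 : (0 < n)%N).
Variable z : F.
Hypothesis hz : n.-primitive_root z.
Variable hilb : F -> F -> F.
Hypothesis hhilb : is_hilbert_symbol v n hilb.
Variables (m : nat) (Gt : groupType) (p : Gt -> 'M[F]_r) (iota : F -> Gt).
Hypothesis hcover : is_metaplectic_cover hilb n m c d p iota.
Local Notation T := (torus_cover p).
Local Notation T0 := (int_torus_cover v p).
Local Notation B := (Bform c d).
Local Notation e j := (delta_mx j 0 : 'cV[int]_r).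

Let hv : is_discrete_valuation v. Proof. by case: hF. Qed.
Let hext : is_central_extension m p iota. Proof. exact: cover_ext hcover. Qed.

Lemma hilb_neq0 x u : x != 0 -> u != 0 -> hilb x u != 0.
Proof.
move=> x0 u0; have [hX _] := hilbert_symbol_morph n0 hz hhilb u0.
apply: contra_eq_neq (hX x x0) => ->.
by rewrite expr0n gtn_eqF // eq_sym oner_eq0.
Qed.

(** The commutator is [iota] of a power of the symbol. That power is an m-th root of unity since n
    divides m, and [iota] is injective on those. *)
Lemma cover_commuteP g h (lam mu : 'cV[int]_r) x y : x != 0 -> y != 0 ->
  p g = cochar lam x -> p h = cochar mu y ->
  commute g h <-> hilb x y ^ B lam mu = 1.
Proof.
move=> x0 y0 Eg Eh; have E := cover_comm hcover x0 y0 Eg Eh.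
have r1 : m.-unity_root (1 : F) by apply/unity_rootP; rewrite expr1n.
split=> [/commgP/eqP|h1]; last by apply/commgP; rewrite E h1 (iota1 hext).
rewrite E -(iota1 hext); apply: (cover_iota_inj hext) r1.
apply/unity_rootP; have [k ->] := dvdnP (cover_deg_dvd hcover).
rewrite exprnP exprz_exp mulrC -exprz_exp -exprnP mulnC exprM.
by have [hX _] := hilbert_symbol_morph n0 hz hhilb y0; rewrite hX // expr1n exp1rz.
Qed.

Hypothesis T0_abelian : is_abelian T0.

Lemma int_torus_cochar g lam u : unit_int v u -> p g = cochar lam u -> T0 g.
Proof.
move=> [u0 vu] Eg; split=> [|i]; first by rewrite Eg diag_mx_is_diag.
by rewrite Eg cocharE; split; rewrite ?expfz_neq0 // valuationXz // vu mul0r.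
Qed.

Lemma int_torus_commute a (lam : 'cV[int]_r) pi : pi != 0 ->
  p a = cochar lam pi -> in_radical c d n lam ->
  forall b, T0 b -> commute a b.
Proof.
move=> pi0 Ea /in_radicalP hlam b [Tb hb].
apply: (torus_commute hext (P := unit_int v)) Tb hb => j h u [u0 _] Eh.
apply/(cover_commuteP pi0 u0 Ea Eh)/(@expz_dvd_eq1 _ _ n) => //.
by have [hX _] := hilbert_symbol_morph n0 hz hhilb u0; exact: hX.
Qed.

Lemma int_torus_commute_radical a (lam : 'cV[int]_r) pi : pi != 0 -> v pi = 1 ->
  p a = cochar lam pi -> (forall b, T0 b -> commute a b) ->
  in_radical c d n lam.
Proof.
move=> pi0 vpi Ea ha; apply/forallP => j; set k := B lam (e j).
have [_ _ [q hq]] := hF.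
apply: (dvdn_of_unit_powers hv hq n0 hz) => u uu; have [u0 _] := uu.
have [h Eh _] := cochar_lift hext (e j) u0.
have T0h := int_torus_cochar uu Eh.
have [hX hM] := hilbert_symbol_morph n0 hz hhilb u0.
have hpi : hilb pi u ^ k = 1 by apply/(cover_commuteP pi0 u0 Ea Eh)/ha.
have hunit w : unit_int v w -> hilb w u ^ k = 1.
  move=> uw; have [w0 _] := uw.
  (* Here k is the sum of the lam_i B(e_i, e_j), and each (w, u)^B(e_i, e_j) is 1 because unit torus
     elements commute. *)
  rewrite /k Bform_suml; apply: expz_sum_eq1 => [|i]; first exact: hilb_neq0.
  have [h' Eh' _] := cochar_lift hext (e i) w0.
  apply/(cover_commuteP w0 u0 Eh' Eh)/T0_abelian => //.
  exact: int_torus_cochar uw Eh'.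
have hpiX i : hilb (pi ^+ i) u ^ k = 1.
  elim: i => [|i IH].
    by rewrite expr0; apply: hunit; split; rewrite ?oner_eq0 ?valuation1.
  by rewrite exprS hM ?expf_neq0 // expfzMl hpi IH mulr1.
(* According to the sign of its valuation, [x] becomes a unit after division or multiplication by a
   power of [pi]. *)
apply: (hilbert_radical n0 hz hhilb u0) => x x0; apply: expz_absz_eq1.
have [i [Ei|Ei]] : exists i : nat, v x = i%:Z \/ v x = - i%:Z.
  by exists `|v x|%N; lia.
  rewrite -[x](divfK (expf_neq0 i pi0)) hM ?expf_neq0 //; last first.
    by rewrite mulf_neq0 ?invr_eq0 ?expf_neq0.
  rewrite expfzMl hpiX mulr1; apply: hunit.
  split; first by rewrite mulf_neq0 ?invr_eq0 ?expf_neq0.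
  rewrite valuationM ?valuationV ?invr_eq0 ?expf_neq0 // valuationX // vpi Ei.
  by rewrite natz subrr.
have : hilb (x * pi ^+ i) u ^ k = 1.
  apply: hunit; split; first by rewrite mulf_neq0 ?expf_neq0.
  by rewrite valuationM ?expf_neq0 // valuationX // vpi Ei natz addNr.
by rewrite hM ?expf_neq0 // expfzMl hpiX mulr1.
Qed.

Variable H : set Gt.
Hypothesis hH : is_maximal_abelian T H.
Hypothesis hHint : T0 `<=` H.

Lemma maximal_abelianE : H = [set g | T g /\ in_radical c d n (weight p v g)].
Proof.
have [[H1 HM HV] HT Hab Hmax] := hH.
have [pi pi0 vpi] : exists2 x, x != 0 & v x = 1 by case: hv.
set C := [set g | _].
have HC : H `<=` C.
  move=> g Hg; have Tg := HT g Hg; split=> //.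
  have [a [b [Eg Ea T0b]]] := torus_decomposition hext hv Tg pi0 vpi.
  apply: (int_torus_commute_radical pi0 vpi Ea) => b' T0b'.
  have -> : a = (g * b^-1)%g by rewrite Eg mulgK.
  exact: Hab (HM _ _ Hg (HV _ (hHint T0b))) (hHint T0b').
(* By maximality of H, equality follows once [C] is an abelian subgroup of the torus. *)
apply/seteqP; split=> //; apply: Hmax => // [||g h [Tg hg] [Th hh]].
- have CV g h : C g -> C h -> C (g^-1 * h)%g.
    move=> [Tg hg] [Th hh]; split; first exact: (torus_div hext Tg Th).
    by rewrite (weight_div hext) // in_radicalB.
  have C1 : C 1%g by exact: HC.
  have CVg g : C g -> C (g^-1)%g.
    by move=> Cg; rewrite -[(g^-1)%g]mulg1; apply: CV.
  split=> // g h Cg Ch; rewrite -[g]invgK; apply: CV => //; exact: CVg.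
- by move=> g [].
have [a [b [Eg Ea T0b]]] := torus_decomposition hext hv Tg pi0 vpi.
have [a' [b' [Eh Ea' T0b']]] := torus_decomposition hext hv Th pi0 vpi.
have ab' := int_torus_commute pi0 Ea hg T0b'.
have a'b := int_torus_commute pi0 Ea' hh T0b.
have bb' : commute b b' := T0_abelian T0b T0b'.
(* The commutator is the image of (pi, pi) raised to a multiple of n, the weight of [g] being in the
   radical. *)
have aa' : commute a a'.
  apply/(cover_commuteP pi0 pi0 Ea Ea')/(@expz_dvd_eq1 _ _ n).
    by have [hX _] := hilbert_symbol_morph n0 hz hhilb pi0; exact: hX.
  by move/in_radicalP: hg.
suff : commute g h by [].
by rewrite Eg Eh; apply/commuteM; apply/commute_sym/commuteM => //; apply/commute_sym.
Qed.

End Cover.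

(** * Counting the cosets of H *)

Lemma card_eq_finset (I : finType) (A : {set I}) : ([set` A] #= `I_#|A|)%card.
Proof.
apply: card_esym; rewrite (card_eql card_II).
have -> : [set` A] = [set enum_val i | i in [set: 'I_#|A|]].
  apply/seteqP; split=> [x /= xA|_ /= [i _ <-]]; last exact: enum_valP.
  by exists (enum_rank_in xA x) => //; rewrite enum_rankK_in.
by apply: card_esym; apply: inj_card_eq => i j _ _; exact: enum_val_inj.
Qed.

Theorem theorem1p1 (F : fieldType) (v : F -> int) (n r : nat) (c d : int)
    (hF : is_local_field v)
    (hn : (0 < n)%N) (hr : (0 < r)%N)
    (hroots : has_unity_roots F (2 * n)%N)
    (hilb : F -> F -> F) (hhilb : is_hilbert_symbol v n hilb)
    (m : nat) (Gt : groupType) (p : Gt -> 'M[F]_r) (iota : F -> Gt)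
    (hcover : is_metaplectic_cover hilb n m c d p iota)
    (H : set Gt)
    (hH : is_maximal_abelian (torus_cover p) H)
    (hHint : int_torus_cover v p `<=` H) :
  exists k : nat,
    (left_cosets (torus_cover p) H #= `I_k)%card /\
    k%:R = (n ^ r)%N%:R / #|Bradical r n c d|%:R :> rat.
Proof.
have [z hz] := has_unity_roots_prim hn (isT : 0 < 2)%N hroots.
have T0ab : is_abelian (int_torus_cover v p).
  by move=> g h /hHint Hg /hHint Hh; case: hH => _ _ Hab _; apply: Hab.
have EH := maximal_abelianE hF hn hz hhilb hcover T0ab hH hHint.
have hext := cover_ext hcover.
have hv : is_discrete_valuation v by case: hF.
clear hroots hhilb hcover hz; case: n => [|n'] // in hn EH *.
exists #|residue_image r n' c d|; split; last first.
  rewrite -(card_residue_image r n' c d) natrM mulfK // pnatr_eq0 -lt0n; apply/card_gt0P.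
  (* The zero vector lies in the radical, so the denominator is nonzero. *)
  exists [ffun => ord0]; rewrite mem_Bradical.
  rewrite (_ : lift_Zn _ = 0) ?in_radical0 //.
  by apply/matrixP => i j; rewrite !mxE ffunE.
(* The cosets of H are the nonempty fibres of the residue vector of the weight. *)
pose f (y : {ffun 'I_r -> 'I_n'.+1}) : set Gt :=
  [set g | torus_cover p g /\ residues n' c d (weight p v g) = y].
have cosetE t : torus_cover p t ->
    [set g | H (t^-1 * g)%g] = f (residues n' c d (weight p v t)).
  move=> Tt; rewrite EH; apply/seteqP; split=> g /= [Tg].
    have {}Tg : torus_cover p g by rewrite -[g](mulVKg t); exact: torusM hext _ _ Tt Tg.
    by rewrite (weight_div hext) // => /residuesP.
  move=> /residuesP; rewrite -(weight_div hext) //; split=> //.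
  exact: (torus_div hext Tt Tg).
have [pi pi0 vpi] : exists2 x, x != 0 & v x = 1 by case: hv.
have lift lam : exists2 t, torus_cover p t & weight p v t = lam.
  have [t Et Tt] := cochar_lift hext lam pi0; exists t => //.
  exact: weight_cochar hv _ _ _ pi0 vpi Et.
have -> : left_cosets (torus_cover p) H = f @` [set` residue_image r n' c d].
  apply/seteqP; split=> [_ [t Tt ->]|_ [_ /imsetP[y _ ->] <-]].
    rewrite cosetE //; exists (residues n' c d (weight p v t)) => //=.
    by have [y ->] := residues_lift n' c d (weight p v t); apply: imset_f.
  by have [t Tt Et] := lift (lift_Zn y); exists t => //; rewrite cosetE // Et.
(* Fibres over [residue_image] are nonempty, each weight being attained by a lift of pi^lambda; a
   common element forces equal indices, so [f] is injective there. *)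
rewrite (card_eql (inj_card_eq _)); first exact: card_eq_finset.
move=> y y' /set_mem/imsetP[x _ ->] _ E.
have [t Tt Et] := lift (lift_Zn x).
have : f (residues n' c d (lift_Zn x)) t by split=> //; rewrite Et.
by rewrite E => -[_ <-]; rewrite Et.
Qed.
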